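(* Let $X$ be a real Banach space. Suppose that $T:X\rightrightarrows X^*$ is maximal monotone and $T$ is nonlinear, that is, $T$ is not an affine subspace of $X\times X^*$. Then $T$ has a unique maximal monotone extension to the bidual if, and only if, $T$ is of Gossez type (D).
   Context: $X$ is a real Banach space with dual $X^*$ and bidual $X^{**}$; $X$ is identified with its canonical image in $X^{**}$. Duality products: $\langle x,x^*\rangle=x^*(x)$ on $X\times X^*$ and $\langle x^*,x^{**}\rangle=x^{**}(x^* )$ on $X^*\times X^{**}$; the order of the arguments is immaterial. A point-to-set operator $T:X\rightrightarrows X^*$ (resp. $T:X^{**}\rightrightarrows X^*$) is a subset of $X\times X^*$ (resp. $X^{**}\times X^*$). It is monotone if $\langle q-q',r-r'\rangle\ge0$ for all $(q,r),(q',r')\in T$, and maximal monotone if it is monotone and maximal under inclusion among monotone subsets of $X\times X^*$ (resp. of $X^{**}\times X^*$). A maximal monotone extension of $T:X\rightrightarrows X^*$ to the bidual is a maximal monotone operator $\tilde T:X^{**}\rightrightarrows X^*$ (maximal in $X^{**}\times X^*$) containing $T$. Gossez's monotone closure of a maximal monotone $T:X\rightrightarrows X^*$ is $\overline{T}^{\,g}=\{(x^{**},x^* )\in X^{**}\times X^*:\langle x^*-y^*,x^{**}-y\rangle\ge0\ \forall (y,y^* )\in T\}$. $T$ is of Gossez type (D) if for every $(x^{**},x^* )\in\overline{T}^{\,g}$ there is a bounded net in $T$ converging to $(x^{**},x^* )$ in the $\sigma(X^{**},X^* )\times$strong topology of $X^{**}\times X^*$. *)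

(* Defs.v *)
From HB Require Import structures.
From mathcomp Require Import all_boot all_order all_algebra.
From mathcomp Require Import all_classical all_reals all_analysis.

Set Implicit Arguments.
Unset Strict Implicit.
Unset Printing Implicit Defensive.
Import Order.TTheory GRing.Theory Num.Theory.
Import numFieldNormedType.Exports.

Local Open Scope classical_set_scope.
Local Open Scope ring_scope.

(* The topological dual of a real normed space, with the operator norm. *)
Section dual_space.
Context (R : realType) (V : normedModType R).

Definition continuous_linear : {pred (V -> R^o)} :=
  fun f => `[< linear f /\ continuous f >].

Record dual : Type := Dual {
  dual_fun :> V -> R^o;
  dual_funP : dual_fun \in continuous_linear }.

HB.instance Definition _ := [isSub for dual_fun].
HB.instance Definition _ := [Choice of dual by <:].

Lemma continuous_linear_submod : submod_closed continuous_linear.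
Proof.
split.
  apply/asboolP; split; last by move=> x; exact: cvg_cst.
  by move=> a x y /=; rewrite scaler0 addr0.
move=> a f g /asboolP[lf cf] /asboolP[lg cg]; apply/asboolP; split.
  move=> b x y; rewrite /= !fctE lf lg /GRing.scale /=.
  rewrite !mulrDr mulrCA -!addrA; congr (_ + _).
  by rewrite addrCA.
move=> x; apply: cvgD; last exact: cg.
by apply: cvgZl_tmp; exact: cf.
Qed.

HB.instance Definition _ := GRing.isSubmodClosed.Build R (V -> R^o)
  continuous_linear continuous_linear_submod.
HB.instance Definition _ := [SubChoice_isSubLmodule of dual by <:].

Lemma dualD (f g : dual) x : (f + g) x = f x + g x.
Proof. by []. Qed.

Lemma dualZ a (f : dual) x : (a *: f) x = a *: f x.
Proof. by []. Qed.

Lemma dual_linear (f : dual) : linear f.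
Proof. by case: f => f /= /asboolP[]. Qed.

Lemma dual_continuous (f : dual) : continuous f.
Proof. by case: f => f /= /asboolP[]. Qed.

HB.instance Definition _ (f : dual) :=
  GRing.isLinear.Build R V R^o *:%R f (dual_linear f).

Definition dual_norm (f : dual) : R :=
  sup [set `|f x| | x in [set x : V | `|x| <= 1]].

Lemma dual_bounded (f : dual) : exists M, forall x, `|f x| <= M * `|x|.
Proof.
have /linear_boundedP := @continuous_linear_bounded _ _ _ 0 f
  (@dual_continuous f 0).
by move=> /pinfty_ex_gt0[M _ fM]; exists M.
Qed.

Lemma dual_norm_has_sup (f : dual) :
  has_sup [set `|f x| | x in [set x : V | `|x| <= 1]].
Proof.
split; first by exists `|f 0|; exists 0 => //=; rewrite normr0.
have [M fM] := dual_bounded f; exists `|M| => _ [x /= x1 <-].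
rewrite (le_trans (fM x))// (le_trans (ler_wpM2r _ (ler_norm M)))//.
by rewrite ler_piMr.
Qed.

Lemma dual_norm_ub (f : dual) x : `|x| <= 1 -> `|f x| <= dual_norm f.
Proof.
by move=> x1; apply: ub_le_sup; [case: (dual_norm_has_sup f)|exists x].
Qed.

Lemma dual_norm_le (f : dual) M :
  (forall x, `|x| <= 1 -> `|f x| <= M) -> dual_norm f <= M.
Proof.
move=> fM; apply: ge_sup; first by case: (dual_norm_has_sup f).
by move=> _ [x /= x1 <-]; exact: fM.
Qed.

Lemma dual_normP (f : dual) x : `|f x| <= dual_norm f * `|x|.
Proof.
have [->|x0] := eqVneq x 0; first by rewrite linear0 !normr0 mulr0.
have nx0 : 0 < `|x| by rewrite normr_gt0.
rewrite -ler_pdivrMr// mulrC.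
have -> : `|x|^-1 * `|f x| = `|f (`|x|^-1 *: x)|.
  by rewrite linearZ normrZ ger0_norm// invr_ge0.
by apply: dual_norm_ub; rewrite normrZ normfV normr_id mulVf// gt_eqF.
Qed.

Let dual_normD (f g : dual) : dual_norm (f + g) <= dual_norm f + dual_norm g.
Proof.
apply: dual_norm_le => x x1.
by rewrite (le_trans (ler_normD _ _))// lerD// dual_norm_ub.
Qed.

Let dual_normZ_le a (f : dual) : dual_norm (a *: f) <= `|a| * dual_norm f.
Proof.
apply: dual_norm_le => x x1.
by rewrite dualZ normrZ ler_wpM2l// dual_norm_ub.
Qed.

Let dual_normZ a (f : dual) : dual_norm (a *: f) = `|a| * dual_norm f.
Proof.
apply/eqP; rewrite eq_le dual_normZ_le /=.
have [->|a0] := eqVneq a 0.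
  rewrite normr0 mul0r (le_trans _ (@dual_norm_ub _ 0 _))//.
  by rewrite normr0.
have := dual_normZ_le a^-1 (a *: f).
by rewrite scalerA mulVf// scale1r normfV mulrC ler_pdivlMr ?normr_gt0// mulrC.
Qed.

Let dual_norm0_eq0 (f : dual) : dual_norm f = 0 -> f = 0.
Proof.
move=> f0; apply/val_inj/funext => x; apply/eqP; rewrite -normr_le0.
by rewrite (le_trans (dual_normP f x))// f0 mul0r.
Qed.

HB.instance Definition _ := Lmodule_isNormed.Build R dual
  dual_normD dual_normZ dual_norm0_eq0.

Lemma dual_normE (f : dual) :
  `|f| = sup [set `|f x| | x in [set x : V | `|x| <= 1]].
Proof. by []. Qed.

Lemma dual_norm_apply (f : dual) x : `|f x| <= `|f| * `|x|.
Proof. exact: dual_normP. Qed.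

(* The weak-* topology sigma(V^*, V): pointwise convergence on V. *)
Definition weak_star : Type :=
  initial_topology (fun f : dual => (f : {ptws V -> R^o})).

HB.instance Definition _ := Uniform.on weak_star.

Lemma weak_star_cvgP (I : Type) (F : set_system I) (FF : Filter F)
    (f : I -> weak_star) (g : weak_star) :
  f @ F --> g <->
  forall x : V, (f i : dual) x @[i --> F] --> ((g : dual) x : R^o).
Proof.
split=> [fg x|fg].
  have c : continuous (fun u : weak_star => (u : dual) : {ptws V -> R^o}).
    exact: initial_continuous.
  have p : {for ((g : dual) : {ptws V -> R^o}),
      continuous (fun u : {ptws V -> R^o} => u x)}.
    exact: (@proj_continuous V (fun=> R^o) x).
  apply: (@cvg_comp _ _ _ f (fun u : weak_star => (u : dual) x : R^o) F
    (nbhs g)) => // A gA.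
  exact: (c g _ (p _ gA)).
move=> A /= [_ [[B oB <-] Bg BA]].
have : (fun i => (f i : dual) : {ptws V -> R^o}) @ F -->
       ((g : dual) : {ptws V -> R^o}) by apply/pointwise_cvgP.
move=> /(_ B (open_nbhs_nbhs (conj oB Bg))); rewrite /= !nbhs_simpl /= => FB.
by apply: (@filterS _ F _ _ _ _ FB) => i Bi; exact: (BA (f i)).
Qed.

End dual_space.

Section bidual.
Context (R : realType) (X : normedModType R).

Lemma eval_continuous_linear (x : X) :
  ((fun f : dual X => f x) : dual X -> R^o) \in @continuous_linear R (dual X).
Proof.
apply/asboolP; split=> [a f g|]; first by [].
have le : linear (fun f : dual X => f x : R^o) by [].
pose e : {linear dual X -> R^o} := HB.pack (fun f : dual X => f x : R^o)
  (GRing.isLinear.Build R (dual X) R^o *:%R _ le).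
suff : continuous e by [].
apply/linear_bounded_continuous/bounded_funP => r; exists (r * `|x|) => f fr.
by rewrite (le_trans (dual_norm_apply f x))// ler_wpM2r.
Qed.

(* The canonical map X -> X^** *)
Definition to_bidual (x : X) : dual (dual X) :=
  Dual (eval_continuous_linear x).

Lemma to_bidualE x (f : dual X) : to_bidual x f = f x.
Proof. by []. Qed.

End bidual.

Section monotone_operators.
Context (R : realType).

(* Operators are identified with their graphs. Both dualities X x X^* and
   X^** x X^* are covered by making the pairing a parameter. *)
Definition monotone_op (U W : zmodType) (pair : U -> W -> R)
    (T : set (U * W)) :=
  forall p q, T p -> T q -> 0 <= pair (p.1 - q.1) (p.2 - q.2).

Definition maximal_monotone_op (U W : zmodType) (pair : U -> W -> R)
    (T : set (U * W)) :=
  monotone_op pair T /\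
  forall S, monotone_op pair S -> T `<=` S -> S = T.

Context (X : normedModType R).
Implicit Type T : set (X * dual X).

Definition duality (x : X) (xs : dual X) : R := xs x.
Definition biduality (xss : dual (dual X)) (xs : dual X) : R := xss xs.

Definition maximal_monotone_extension T (S : set (dual (dual X) * dual X)) :=
  maximal_monotone_op biduality S /\
  forall x xs, T (x, xs) -> S (to_bidual x, xs).

Definition gossez_closure T : set (dual (dual X) * dual X) :=
  [set p | forall y ys, T (y, ys) ->
     0 <= biduality (p.1 - to_bidual y) (p.2 - ys)].

Definition directed (I : Type) (le : I -> I -> Prop) :=
  [/\ inhabited I, forall i, le i i,
      forall i j k, le i j -> le j k -> le i k &
      forall i j, exists k, le i k /\ le j k].

Definition net_tails (I : Type) (le : I -> I -> Prop) : set_system I :=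
  filter_from setT (fun i => [set j | le i j]).

(* The topology on [weak_star (dual X) * dual X] is the product of
   the weak-* topology of X^** and the norm topology of X^*. *)
Definition gossez_type_D T :=
  forall xss xs, gossez_closure T (xss, xs) ->
  exists (I : Type) (le : I -> I -> Prop) (z : I -> X * dual X),
    [/\ directed le, forall i, T (z i), bounded_set (range z) &
        (to_bidual (z i).1, (z i).2) @[i --> net_tails le] -->
          ((xss, xs) : weak_star (dual X) * dual X)].

End monotone_operators.

Definition affine_subspace (R : realType) (V : lmodType R) (A : set V) :=
  exists (a : V) (L : {pred V}),
    submod_closed L /\ A = [set a + v | v in [set` L]].

(* Main.v *)
(** Write [pi] for the duality product and [phi(z) = sup_{t in T} (<z, t> - pi t)]
    for the Fitzpatrick function of [T] on [X^** x X^*], so that the Gossez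
    closure is [{phi <= pi}].
    Uniqueness of the extension amounts to monotonicity of the closure. If
    moreover [phi(z0) < pi(z0)] somewhere, then the segments from [z0] into the
    domain of [phi] start inside the closure, so that domain is monotone; it is
    then the closure, which is convex and maximal monotone, hence affine. So for
    nonlinear [T] we get [phi >= pi] everywhere (class (NI)).
    Under (NI), Fenchel duality yields two approximations: from a point of
    [X x X^*] with [phi <= pi + eps] one reaches [T] at distance
    [O(sqrt eps)] by an iteration with geometric steps (Broendsted-Rockafellar), and
    a point of the closure is a bounded weak-star x strong limit of points with
    [phi <= pi + eps], because [phi] dominates [pi] and touches it there.
    Together they give type (D). *)
From HB Require Import structures.
Require Import Defs.
From mathcomp Require Import all_boot all_order all_algebra.
From mathcomp Require Import all_classical all_reals all_analysis.
From mathcomp Require Import ring lra.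
Set Implicit Arguments.
Unset Strict Implicit.
Unset Printing Implicit Defensive.
Import Order.TTheory GRing.Theory Num.Theory.
Import numFieldNormedType.Exports.
Local Open Scope classical_set_scope.
Local Open Scope ring_scope.

(** * Hahn-Banach and Fenchel duality *)

Section hahn_banach.
Context (R : realType) (E : lmodType R).

Definition convex_real (k : E -> R) := forall x y t, 0 <= t <= 1 ->
  k (t *: x + (1 - t) *: y) <= t * k x + (1 - t) * k y.

(* Linear functionals are handled through their graphs; a linear graph lying
   below a function [k] with [k 0 = 0] is automatically single-valued. *)
Definition linear_minorant (k : E -> R) (A : set (E * R)) :=
  (forall a x y r s, A (x, r) -> A (y, s) -> A (a *: x + y, a * r + s)) /\
  (forall x r, A (x, r) -> r <= k x).

(** One-dimensional step of Hahn-Banach. The value [c] at [x] must lie above every slope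
    [(r - k (y - s *: x)) / s] and below every slope [(k (y + s *: x) - r) / s] with [s > 0];
    convexity of [k] puts the former below the latter, and [c] is the supremum of the former. *)
Lemma linear_minorant_extend (k : E -> R) (A : set (E * R)) (x : E) :
  convex_real k -> linear_minorant k A -> A (0, 0) ->
  exists c, linear_minorant k
    [set p | exists y r s, A (y, r) /\ p = (y + s *: x, r + s * c)].
Proof.
move=> kconv [Alin Ak] A0.
have AZ a y r : A (y, r) -> A (a *: y, a * r).
  by move=> Ay; rewrite -[X in (X, _)]addr0 -[X in (_, X)]addr0; exact: Alin.
have sep y r s y' r' s' : A (y, r) -> A (y', r') -> 0 < s -> 0 < s' ->
    (r' - k (y' - s' *: x)) / s' <= (k (y + s *: x) - r) / s.
  move=> Ay Ay' s0 s'0; have ss0 : 0 < s + s' by lra.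
  have ssn : s + s' != 0 by lra.
  (* This weight gives [t * s = (1 - t) * s'], so that [x] cancels from the convex combination. *)
  set t := s' / (s + s').
  have t1 : 1 - t = s / (s + s') by rewrite /t; field.
  have t01 : 0 <= t <= 1.
    by rewrite /t divr_ge0 ?ler_pdivrMr; lra.
  have := kconv (y + s *: x) (y' - s' *: x) t t01.
  have -> : t *: (y + s *: x) + (1 - t) *: (y' - s' *: x)
      = t *: y + (1 - t) *: y'.
    rewrite !scalerDr scalerN !scalerA t1 /t addrACA.
    have -> : s' / (s + s') * s = s / (s + s') * s' by field.
    by rewrite subrr addr0.
  have := Ak _ _ (Alin t _ _ _ _ Ay (AZ (1 - t) _ _ Ay')).
  move=> /le_trans/[apply]; rewrite t1 /t => h.
  rewrite ler_pdivrMr// mulrAC ler_pdivlMr//.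
  rewrite -subr_ge0 in h.
  have h2 : 0 <= (s + s') * (s' / (s + s') * k (y + s *: x) + s / (s + s') *
      k (y' - s' *: x) - (s' / (s + s') * r + s / (s + s') * r')).
    by rewrite mulr_ge0// ltW.
  have E1 : (s + s') * (s' / (s + s') * k (y + s *: x) + s / (s + s') *
      k (y' - s' *: x) - (s' / (s + s') * r + s / (s + s') * r')) =
      s' * k (y + s *: x) + s * k (y' - s' *: x) - (s' * r + s * r') by field.
  rewrite E1 in h2; nra.
pose L := [set c | exists y r s, [/\ A (y, r), 0 < s &
  c = (r - k (y - s *: x)) / s]].
have Lne : L !=set0 by exists ((0 - k (0 - 1 *: x)) / 1); exists 0, 0, 1.
have Lub y r s : A (y, r) -> 0 < s -> ubound L ((k (y + s *: x) - r) / s).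
  by move=> Ay s0 _ [y' [r' [s' [Ay' s'0 ->]]]]; exact: sep.
have Lsup : has_sup L by split=> //; eexists; exact: (Lub 0 0 1).
exists (sup L); split.
  move=> a _ _ _ _ [y [r [s [Ay [-> ->]]]]] [y' [r' [s' [Ay' [-> ->]]]]].
  exists (a *: y + y'), (a * r + r'), (a * s + s'); split; first exact: Alin.
  congr pair; last by ring.
  by rewrite scalerDr scalerDl scalerA addrACA.
move=> _ _ [y [r [s [Ay [-> ->]]]]].
have [s0|s0|->] := ltgtP s 0; last by rewrite scale0r addr0 mul0r addr0; exact: Ak.
  have : (r - k (y - (- s) *: x)) / (- s) <= sup L.
    by apply: ub_le_sup; [case: Lsup|exists y, r, (- s); split=> //; lra].
  by rewrite ler_pdivrMr ?oppr_gt0// scaleNr opprK; nra.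
have : sup L <= (k (y + s *: x) - r) / s by apply: ge_sup => //; exact: Lub.
by rewrite ler_pdivlMr//; nra.
Qed.

(** Zorn's lemma on the linear minorants of [k - k 0]. A maximal one has full domain by the
    one-dimensional step, and is single-valued because [(0, r)] in the graph forces [a * r <= 0] for
    every [a]. *)
Lemma hahn_banach_convex (k : E -> R) : convex_real k ->
  exists g : {linear E -> R^o}, forall v, k 0 + g v <= k v.
Proof.
move=> kconv0; pose h v := k v - k 0.
have hconv : convex_real h.
  by move=> x y t t01; have := kconv0 x y t t01; rewrite /h; nra.
have h0 : h 0 = 0 by rewrite /h subrr.
have [F FP Ftot|A [[Alin Ah] Amax]] := @Zorn_bigcup _ (linear_minorant h).
  split=> [a x y r s [B FB Bx] [C FC Cy]|x r [B FB Bx]].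
    have [BC|CB] := Ftot _ _ FB FC.
      by exists C => //; apply: (FP _ FC).1 => //; exact: BC.
    by exists B => //; apply: (FP _ FB).1 => //; exact: CB.
  exact: (FP _ FB).2.
(* The empty graph also qualifies as a linear minorant. A maximal graph avoiding the origin would be
   empty, hence strictly below the graph reduced to the origin. *)
have A0 : A (0, 0).
  apply: contrapT => nA0.
  have Ane x r : ~ A (x, r).
    move=> Ax; apply: nA0; have := Alin (- 1) _ _ _ _ Ax Ax.
    by rewrite scaleN1r addNr mulN1r addNr.
  apply: (Amax [set (0, 0)]).
    by split=> [[x r] /Ane//|/(_ (0, 0))/(_ erefl)].
  split=> [a x y r s [-> ->] [-> ->]|x r [-> ->]].
    by rewrite scaler0 mulr0 !addr0.
  by rewrite h0.
have Aall x : exists r, A (x, r).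
  have [c cP] := linear_minorant_extend x hconv (conj Alin Ah) A0.
  apply: contrapT => nA; apply: (Amax _ _ cP); split.
    by move=> [y r] Ay; exists y, r, 0; rewrite scale0r mul0r !addr0.
  move=> /(_ (x, c)) Ax; apply: nA; exists c; apply: Ax.
  by exists 0, 0, 1; rewrite scale1r mul1r !add0r.
have Auniq0 r : A (0, r) -> r = 0.
  move=> Ar; have Z a : a * r <= 0.
    have := Ah _ _ (Alin a _ _ _ _ Ar A0).
    by rewrite scaler0 !addr0 h0.
  by have := Z 1; have := Z (- 1); lra.
have [g gP] := choice Aall.
have glin : linear (g : E -> R^o).
  move=> a x y; apply/eqP; rewrite -subr_eq0; apply/eqP/Auniq0.
  have := Alin (- 1) _ _ _ _ (Alin a _ _ _ _ (gP x) (gP y)) (gP (a *: x + y)).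
  by rewrite scaleN1r addNr mulN1r [- _ + _]addrC.
pose gl := GRing.isLinear.Build R E R^o *:%R g glin.
pose G : {linear E -> R^o} := HB.pack g gl.
exists G => v; have := Ah _ _ (gP v); rewrite /h /=; lra.
Qed.

End hahn_banach.

Section fenchel.
Context (R : realType) (E : lmodType R).

Definition convex_epi (G : set (E * R)) := forall x r y s t, 0 <= t <= 1 ->
  G (x, r) -> G (y, s) -> G (t *: x + (1 - t) *: y, t * r + (1 - t) * s).

(* Hahn-Banach is applied to the infimal convolution of [G] and [N], which is
   finite everywhere because it is convex and bounded below at the origin. *)
Lemma fenchel_duality (N : E -> R) (G : set (E * R)) (c : R) :
  convex_real N -> convex_epi G -> G !=set0 ->
  (forall q r, G (q, r) -> c <= r + N q) ->
  exists g : {linear E -> R^o}, forall q r u, G (q, r) ->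
    c + g q - g u <= r + N u.
Proof.
move=> Nconv Gconv [[q0 r0] G0] Gc.
pose S v := [set a | exists q r, G (q, r) /\ a = r + N (q - v)].
have Sne v : S v !=set0 by exists (r0 + N (q0 - v)), q0, r0.
have Sinf v : has_inf (S v).
  (* The points [q - v] and [q0 + v] have the same midpoint as [q] and [q0]; the hypothesis on [c]
     at that midpoint gives this lower bound. *)
  split=> //; exists (2 * c - (r0 + N (q0 + v))) => _ [q [r [Gq ->]]].
  have h : 0 <= (2^-1 : R) <= 1 by lra.
  have := Gc _ _ (Gconv _ _ _ _ _ h Gq G0).
  have := Nconv (q - v) (q0 + v) _ h.
  have -> : 2^-1 *: (q - v) + (1 - 2^-1) *: (q0 + v) =
      2^-1 *: q + (1 - 2^-1) *: q0.
    have -> : 1 - 2^-1 = 2^-1 :> R by lra.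
    by rewrite -!scalerDr addrACA addNr addr0.
  lra.
pose k v := inf (S v).
have kle v q r : G (q, r) -> k v <= r + N (q - v).
  by move=> Gq; apply: ge_inf; [case: (Sinf v)|exists q, r].
have kconv : convex_real k.
  move=> x y t t01; apply/ler_addgt0Pr => e e0.
  have [_ [q [r [Gq ->]]] ltx] := inf_adherent e0 (Sinf x).
  have [_ [q' [r' [Gq' ->]]] lty] := inf_adherent e0 (Sinf y).
  apply: (le_trans (kle _ _ _ (Gconv _ _ _ _ _ t01 Gq Gq'))).
  have := Nconv (q - x) (q' - y) t t01.
  have -> : t *: (q - x) + (1 - t) *: (q' - y) =
      t *: q + (1 - t) *: q' - (t *: x + (1 - t) *: y).
    by rewrite !scalerBr addrACA opprD.
  rewrite -!/(k _) in ltx lty *; nra.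
have [g gk] := hahn_banach_convex kconv; exists g => q r u Gq.
have k0 : c <= k 0.
  apply: lb_le_inf => // _ [q' [r' [Gq' ->]]]; rewrite subr0; exact: Gc.
(* At the argument [q - u], the bound [kle] involves exactly [N u]. *)
have := kle (q - u) _ _ Gq; have := gk (q - u).
have -> : q - (q - u) = u by rewrite opprB addrC subrK.
by rewrite linearB /=; lra.
Qed.

End fenchel.

(** * Convex functions and continuity of linear functionals *)

Section convexity.
Context (R : realType).

Lemma convex_realD (E : lmodType R) (k h : E -> R) :
  convex_real k -> convex_real h -> convex_real (fun x => k x + h x).
Proof.
by move=> kc hc x y t t01; have := kc x y t t01; have := hc x y t t01; nra.
Qed.

Lemma convex_realZ (E : lmodType R) (a : R) (k : E -> R) : 0 <= a ->
  convex_real k -> convex_real (fun x => a * k x).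
Proof.
move=> a0 kc x y t t01; have := ler_wpM2l a0 (kc x y t t01).
by move=> /le_trans; apply; rewrite mulrDr !(mulrCA a).
Qed.

Lemma convex_real_linear (E F : lmodType R) (L : E -> F) (k : F -> R) :
  linear L -> convex_real k -> convex_real (k \o L).
Proof.
move=> Llin kc x y t t01 /=; have := kc (L x) (L y) t t01.
suff -> : L (t *: x + (1 - t) *: y) = t *: L x + (1 - t) *: L y by [].
have L0 : L 0 = 0.
  by have := Llin (-1) 0 0; rewrite scaler0 addr0 scaleN1r addNr.
by rewrite -[(1 - t) *: y]addr0 !Llin L0 addr0.
Qed.

Lemma convex_real_sum (E : lmodType R) n (k : 'I_n -> E -> R) :
  (forall i, convex_real (k i)) -> convex_real (fun x => \sum_(i < n) k i x).
Proof.
move=> kc x y t t01; rewrite !mulr_sumr -big_split ler_sum// => i _.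
exact: kc.
Qed.

Lemma convex_real_norm (V : normedModType R) :
  convex_real (fun x : V => `|x|).
Proof.
move=> x y t /andP[t0 t1]; rewrite (le_trans (ler_normD _ _))// !normrZ.
by rewrite (ger0_norm t0) ger0_norm// subr_ge0.
Qed.

Lemma convex_real_sqnorm (V : normedModType R) :
  convex_real (fun x : V => `|x| ^+ 2).
Proof.
move=> x y t t01; have h := @convex_real_norm V x y t t01.
have h2 : `|t *: x + (1 - t) *: y| ^+ 2 <= (t * `|x| + (1 - t) * `|y|) ^+ 2.
  by rewrite ler_sqr ?nnegrE// (le_trans _ h).
apply: (le_trans h2); rewrite -subr_ge0.
have -> : t * `|x| ^+ 2 + (1 - t) * `|y| ^+ 2 - (t * `|x| + (1 - t) * `|y|) ^+ 2
   = t * (1 - t) * (`|x| - `|y|) ^+ 2 by ring.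
by rewrite mulr_ge0 ?sqr_ge0// mulr_ge0//; lra.
Qed.

(** Hahn-Banach yields a functional that is only linear, and Fenchel duality bounds it on one side.
    Applying the bound to [- x] as well makes it two-sided, hence the functional continuous. *)
Lemma dual_of_linear (V : normedModType R) (g : {linear V -> R^o}) (K : R) :
  (forall x, `|x| <= 1 -> - K <= g x) -> exists f : dual V, f =1 g.
Proof.
move=> gK.
have gb x : `|x| <= 1 -> `|g x| <= K.
  move=> x1; rewrite ler_norml gK//=.
  by have := gK (- x); rewrite normrN linearN => /(_ x1); rewrite lerN2.
have gc : continuous g.
  apply/linear_bounded_continuous/bounded_funP => r.
  exists (K * `|r|) => x xr.
  have [->|x0] := eqVneq x 0.
    by rewrite linear0 normr0 mulr_ge0// (le_trans _ (gb 0 _)) ?normr0.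
  have nx0 : 0 < `|x| by rewrite normr_gt0.
  have := gb (`|x|^-1 *: x).
  rewrite linearZ /= normrZ normfV normr_id mulVf ?gt_eqF// => /(_ (lexx _)).
  rewrite [`|_ *: _|]normrM normfV normr_id mulrC ler_pdivrMr// => /le_trans; apply.
  rewrite ler_wpM2l ?(le_trans xr (ler_norm _))//.
  by rewrite (le_trans _ (gb 0 _)) ?normr0.
have gP : (g : V -> R^o) \in @continuous_linear R V.
  by apply/asboolP; split=> //; exact: linearP.
by exists (Dual gP).
Qed.

Lemma dual_scaler (V : normedModType R) (f : dual V) (a : R) x :
  f (a *: x) = a * f x.
Proof. exact: linearZ. Qed.

(* The conjugate of [k |.|^2] is [|.|^2 / (4 k)]. *)
Lemma sqnorm_conjugate (V : normedModType R) (b : dual V) (k F : R) : 0 < k ->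
  (forall u, F <= k * `|u| ^+ 2 + b u) -> `|b| ^+ 2 <= - (4 * k * F).
Proof.
move=> k0 bF.
have bx x : `|x| <= 1 -> `|b x| ^+ 2 <= - (4 * k * F).
  (* This [a] minimizes [k * a ^+ 2 + a * b x]. *)
  move=> x1; pose a : R := - (b x / (2 * k)); have := bF (a *: x).
  rewrite dual_scaler normrZ exprMn real_normK ?num_real// => h.
  have x2 : `|x| ^+ 2 <= 1 by rewrite expr_le1.
  have : F <= k * a ^+ 2 + a * b x.
    apply: (le_trans h); rewrite lerD2r.
    by rewrite ler_wpM2l ?(ltW k0)// ler_piMr// sqr_ge0.
  have -> : k * a ^+ 2 + a * b x = - (b x ^+ 2) / (4 * k).
    by rewrite /a; field; rewrite gt_eqF.
  by rewrite ler_pdivlMr ?mulr_gt0// real_normK ?num_real//; lra.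
have F0 : 0 <= - (4 * k * F).
  by rewrite (le_trans (sqr_ge0 _) (bx 0 _)) ?normr0.
have : `|b| <= Num.sqrt (- (4 * k * F)).
  apply: dual_norm_le => x x1; rewrite -(ger0_norm (normr_ge0 (b x))) -sqrtr_sqr.
  by rewrite ler_sqrt// bx.
by rewrite -ler_sqr ?nnegrE ?sqrtr_ge0// sqr_sqrtr.
Qed.

End convexity.

Section dual_facts.
Context (R : realType) (V : normedModType R).
Implicit Types (f g : dual V) (x y : V) (a : R).

Lemma dual_addr f x y : f (x + y) = f x + f y :> R. Proof. exact: linearD. Qed.
Lemma dual_oppr f x : f (- x) = - f x :> R. Proof. exact: linearN. Qed.
Lemma dual_addl f g x : (f + g) x = f x + g x :> R. Proof. by []. Qed.
Lemma dual_oppl f x : (- f) x = - f x :> R. Proof. by []. Qed.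
Lemma dual_scalel a f x : (a *: f) x = a * f x :> R. Proof. by []. Qed.

Lemma dual_norm_apply_ge f x : - (`|f| * `|x|) <= f x.
Proof. by have := dual_norm_apply f x; rewrite ler_norml => /andP[]. Qed.

End dual_facts.

Local Notation dualE := (dual_addr, dual_oppr, dual_addl, dual_oppl, dual_scaler,
  dual_scalel, to_bidualE).

Lemma linear_pairE (R : realType) (U V : lmodType R)
    (g : {linear (U * V)%type -> R^o}) :
  exists (g1 : {linear U -> R^o}) (g2 : {linear V -> R^o}),
    forall u v, g (u, v) = g1 u + g2 v :> R.
Proof.
have l1 : linear (fun u => g (u, 0) : R^o).
  move=> a x y; rewrite -linearP; congr (g _).
  by congr pair; rewrite /= scaler0 addr0.
have l2 : linear (fun v => g (0, v) : R^o).
  move=> a x y; rewrite -linearP; congr (g _).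
  by congr pair; rewrite /= scaler0 addr0.
pose g1 : {linear U -> R^o} := HB.pack (fun u => g (u, 0) : R^o)
  (GRing.isLinear.Build R U R^o *:%R _ l1).
pose g2 : {linear V -> R^o} := HB.pack (fun v => g (0, v) : R^o)
  (GRing.isLinear.Build R V R^o *:%R _ l2).
exists g1, g2 => u v; rewrite /= -linearD; congr (g _).
by congr pair; rewrite /= ?addr0 ?add0r.
Qed.

Lemma convex_comb_shift (R : pzRingType) (V : lmodType R) (a b c : V) (t : R) :
  t *: (a + b) + (1 - t) *: (a + c) = a + (t *: b + (1 - t) *: c).
Proof. by rewrite !scalerDr addrACA -scalerDl [t + _]addrC subrK scale1r. Qed.

(** * The Fitzpatrick function *)

Section fitzpatrick.
Context (R : realType) (X : normedModType R) (T : set (X * dual X)).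
Implicit Types (xss : dual (dual X)) (xs : dual X) (r : R).

(** The bound [phi <= r] on the Fitzpatrick function, stated without its supremum, which may be
    infinite. *)
Definition fitzpatrick_le xss xs r :=
  forall y ys, T (y, ys) -> xs y + xss ys - ys y <= r.

(* Simons' class (NI). *)
Definition negative_infimum :=
  forall xss xs r, fitzpatrick_le xss xs r -> xss xs <= r.

Lemma fitzpatrick_le_convex xss xs r xss' xs' r' t : 0 <= t <= 1 ->
  fitzpatrick_le xss xs r -> fitzpatrick_le xss' xs' r' ->
  fitzpatrick_le (t *: xss + (1 - t) *: xss') (t *: xs + (1 - t) *: xs')
    (t * r + (1 - t) * r').
Proof.
move=> t01 h h' y ys Ty; rewrite !dualE.
have := h _ _ Ty; have := h' _ _ Ty; nra.
Qed.

Lemma fitzpatrick_le_trans xss xs r r' : r <= r' ->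
  fitzpatrick_le xss xs r -> fitzpatrick_le xss xs r'.
Proof. by move=> rr' h y ys /h/le_trans; exact. Qed.

Lemma to_bidual_addr (x y : X) : to_bidual (x + y) = to_bidual x + to_bidual y.
Proof. by apply/val_inj/funext => f; rewrite /= dual_addr. Qed.

Lemma to_bidual_scaler (a : R) (x : X) : to_bidual (a *: x) = a *: to_bidual x.
Proof. by apply/val_inj/funext => f; rewrite /= dual_scaler. Qed.

Lemma fitzpatrick_le_graph y ys : monotone_op (@duality R X) T -> T (y, ys) ->
  fitzpatrick_le (to_bidual y) ys (ys y).
Proof.
move=> Tm Ty z zs Tz; have : 0 <= (ys - zs) (y - z) := Tm _ _ Ty Tz.
by rewrite !dualE; lra.
Qed.

Hypothesis Tmono : monotone_op (@duality R X) T.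
Hypothesis TNI : negative_infimum.

(** Over an empty graph every [r], even [-1], is an upper bound, which (NI) at the origin
    forbids. *)
Lemma negative_infimum_nonempty : T !=set0.
Proof.
apply: contrapT => T0; suff : (0 : R) <= - 1 by rewrite ler0N1.
have := @TNI 0 0 (-1); apply => y ys Ty.
by exfalso; apply: T0; exists (y, ys).
Qed.

(** Here [r] bounds [phi] minus the tangent of the duality product at [(x0, xs0)], in terms of the
    displacement [(w, ws)]. If adding half the squared norms never brought it below [eta], Fenchel
    duality would give [a] in X^* and [b] in X^** such that (NI) fails at
    [(b + to_bidual x0, a + xs0)]. *)
Lemma fitzpatrick_le_approx x0 xs0 eta : 0 < eta ->
  exists w ws r, fitzpatrick_le (to_bidual (x0 + w)) (xs0 + ws)
      (r + xs0 w + ws x0 + xs0 x0) /\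
    r + 2^-1 * `|w| ^+ 2 + 2^-1 * `|ws| ^+ 2 < eta.
Proof.
move=> eta0; apply: contrapT => nex.
pose N (w : X * dual X) : R := 2^-1 * `|w.1| ^+ 2 + 2^-1 * `|w.2| ^+ 2.
have half0 : 0 <= (2^-1 : R) by lra.
have Nconv : convex_real N.
  by apply: convex_realD; apply: convex_realZ => //;
    apply: (convex_real_linear (k := fun x => `|x| ^+ 2)) => //;
    exact: convex_real_sqnorm.
pose G := [set p : (X * dual X) * R |
  fitzpatrick_le (to_bidual (x0 + p.1.1)) (xs0 + p.1.2)
    (p.2 + xs0 p.1.1 + p.1.2 x0 + xs0 x0)].
have GE w ws r : G ((w, ws), r) = fitzpatrick_le (to_bidual (x0 + w))
    (xs0 + ws) (r + xs0 w + ws x0 + xs0 x0) by [].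
have Gconv : convex_epi G.
  have Gc w v (ws vs : dual X) r s t : 0 <= t <= 1 ->
      G ((w, ws), r) -> G ((v, vs), s) -> G ((t *: w + (1 - t) *: v,
        t *: ws + (1 - t) *: vs), t * r + (1 - t) * s).
    move=> t01 Gw Gv; have := fitzpatrick_le_convex t01 Gw Gv.
    rewrite GE !to_bidual_addr !to_bidual_scaler !convex_comb_shift.
    by apply: fitzpatrick_le_trans; rewrite !dualE /=; lra.
  by move=> [w ws] r [v vs] s t; exact: Gc.
have GT y ys : T (y, ys) -> G ((y - x0, ys - xs0),
    ys y - xs0 (y - x0) - (ys - xs0) x0 - xs0 x0).
  move=> Ty; rewrite GE ![_ + (_ - _)]addrC !subrK.
  apply: fitzpatrick_le_trans (fitzpatrick_le_graph Tmono Ty).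
  by rewrite !dualE; lra.
have [[y0 ys0] T0] := negative_infimum_nonempty.
have [|q r Gq|g gP] := @fenchel_duality _ _ N G eta Nconv Gconv.
- by eexists; exact: (GT _ _ T0).
- rewrite leNgt; apply/negP => lt; apply: nex; exists q.1, q.2, r; split=> //.
  by rewrite -addrA.
have [g1 [g2 gE]] := linear_pairE g.
(* The Fenchel inequality at one point of the graph bounds [g] from below where [N <= 1], in
   particular on the unit ball of each factor; both components of [g] are thus continuous. *)
pose K := ys0 y0 - xs0 (y0 - x0) - (ys0 - xs0) x0 - xs0 x0 + 1 - eta -
  g (y0 - x0, ys0 - xs0).
have gb u : N u <= 1 -> - K <= g u.
  by move=> Nu; have := gP _ _ u (GT _ _ T0); rewrite /K; lra.
have sq1 (V : normedModType R) (v : V) : `|v| <= 1 -> `|v| ^+ 2 <= 1.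
  by move=> v1; rewrite expr_le1.
have [x x1|a aE] := @dual_of_linear _ _ g1 K.
  have := gb (x, 0); rewrite gE linear0 addr0; apply; rewrite /N /= normr0.
  by have := sq1 _ _ x1; lra.
have [x x1|b bE] := @dual_of_linear _ _ g2 K.
  have := gb (0, x); rewrite gE linear0 add0r; apply; rewrite /N /= normr0.
  by have := sq1 _ _ x1; lra.
pose r := a x0 + b xs0 + xs0 x0 - eta - `|a| ^+ 2 / 2 - `|b| ^+ 2 / 2.
have : fitzpatrick_le (b + to_bidual x0) (a + xs0) r.
  move=> y ys Ty; have h u us : eta + a (y - x0) + b (ys - xs0) - a u - b us <=
      ys y - xs0 (y - x0) - (ys - xs0) x0 - xs0 x0 +
      2^-1 * `|u| ^+ 2 + 2^-1 * `|us| ^+ 2.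
    have := gP _ _ (u, us) (GT _ _ Ty); rewrite !gE -!aE -!bE /N /=; lra.
  pose F := a (y - x0) + b (ys - xs0) + eta -
    (ys y - xs0 (y - x0) - (ys - xs0) x0 - xs0 x0).
  (* The infimum over [u], then the one over [us], replaces the two squared norms by minus half the
     squared norms of [a] and [b]. *)
  have hb us : F + `|a| ^+ 2 / 2 <= 2^-1 * `|us| ^+ 2 + b us.
    have /sqnorm_conjugate : forall u,
        F - (2^-1 * `|us| ^+ 2 + b us) <= 2^-1 * `|u| ^+ 2 + a u.
      by move=> u; have := h u us; rewrite /F; lra.
    by move=> /(_ ltac:(lra)); lra.
  have := sqnorm_conjugate _ hb; move=> /(_ ltac:(lra)).
  by rewrite /F /r !dualE; lra.
move=> /TNI; rewrite !dualE /r; have := dual_norm_apply_ge b a.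
have := sqr_ge0 (`|a| - `|b|); nra.
Qed.

End fitzpatrick.

(** * Bronsted-Rockafellar property *)

Section geometric.
Context (R : realType).

Lemma le0_geometric (a c : R) : (forall k, a <= c / 2 ^+ k) -> a <= 0.
Proof.
move=> ac; rewrite leNgt; apply/negP => a0.
pose k := (Num.truncn (c / a)).+1.
have ck : c / a < k%:R by exact: truncnS_gt.
have := ac k; rewrite ler_pdivlMr ?exprn_gt0// => h.
have k2 : k%:R <= 2 ^+ k :> R by rewrite -natrX ler_nat ltnW// ltn_expl.
move: ck; rewrite ltr_pdivrMr// ltNge => /negP; apply.
by rewrite (le_trans _ h)// mulrC ler_wpM2l// ltW.
Qed.

Lemma geometric_dist (V : normedModType R) (u : nat -> V) (c : R) :
  (forall k, `|u k.+1 - u k| <= c / 2 ^+ k) ->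
  forall k m, `|u (k + m)%N - u k| <= 2 * c / 2 ^+ k.
Proof.
move=> uc k m.
have c0 : 0 <= c by have := uc 0%N; rewrite expr0 divr1; exact: le_trans.
have p0 n : 0 < 2 ^+ n :> R by rewrite exprn_gt0.
(* The induction needs the exact partial sum of the geometric series, not only its limit. *)
have : `|u (k + m)%N - u k| <= 2 * c / 2 ^+ k - 2 * c / 2 ^+ (k + m).
  elim: m => [|m IH]; first by rewrite addn0 !subrr normr0.
  rewrite addnS -[u _ - u k](subrKA (u (k + m)%N)).
  rewrite (le_trans (ler_normD _ _))// (le_trans (lerD (uc _) IH))//.
  rewrite exprS invfM; have := p0 (k + m)%N; rewrite -invr_gt0; lra.
move=> /le_trans; apply; rewrite gerBl divr_ge0 ?mulr_ge0//.
Qed.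

Lemma geometric_cvg (V : completeNormedModType R) (u : nat -> V) (c : R) :
  (forall k, `|u k.+1 - u k| <= c / 2 ^+ k) ->
  exists l, forall k, `|l - u k| <= 2 * c / 2 ^+ k.
Proof.
move=> uc; have ud := geometric_dist uc.
have c0 : 0 <= c by have := uc 0%N; rewrite expr0 divr1; exact: le_trans.
have ucvg : cvgn u.
  apply/cauchy_cvgP/cauchy_exP => e e0.
  have [k ke] : exists k, 2 * c / 2 ^+ k < e.
    apply: contrapT => nk; suff : e <= 0 by rewrite leNgt e0.
    apply: (@le0_geometric _ (2 * c)) => k; rewrite leNgt; apply/negP => ke.
    by apply: nk; exists k.
  exists (u k); exists k => // n /= kn; rewrite -ball_normE /= distrC.
  by rewrite -(subnKC kn) (le_lt_trans (ud _ _)).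
exists (limn u) => k; apply/ler_addgt0Pr => e e0.
have /cvgrPdist_lt/(_ _ e0) [n _ nP] : u @ \oo --> limn u by [].
rewrite -(subrKA (u (k + n)%N)) (le_trans (ler_normD _ _))// addrC lerD//.
by apply/ltW/nP => /=; rewrite leq_addl.
Qed.

(** The limit is taken pointwise in the reals. The rate is uniform on the unit ball, so the limit is
    linear and bounded, and convergence holds in the dual norm. *)
Lemma geometric_cvg_dual (V : normedModType R) (u : nat -> dual V) (c : R) :
  (forall k, `|u k.+1 - u k| <= c / 2 ^+ k) ->
  exists l, forall k, `|l - u k| <= 2 * c / 2 ^+ k.
Proof.
move=> uc; have c0 : 0 <= c.
  by have := uc 0%N; rewrite expr0 divr1; exact: le_trans.
have p0 n : 0 < 2 ^+ n :> R by rewrite exprn_gt0.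
have uV x : exists l : R, forall k, `|l - u k x| <= 2 * c * `|x| / 2 ^+ k.
  have [k|l lP] := @geometric_cvg R^o (fun k => u k x : R^o) (c * `|x|).
    have -> : u k.+1 x - u k x = (u k.+1 - u k) x by [].
    by rewrite (le_trans (dual_norm_apply _ _))// mulrAC ler_wpM2r.
  by exists l => k; have := lP k; rewrite [2 * (c * _)]mulrA.
have [l lP] := choice uV.
have llin : linear (l : V -> R^o).
  move=> a x y; apply/eqP; rewrite -subr_eq0 -normr_le0.
  apply: (@le0_geometric _ (2 * c * (`|a *: x + y| + `|a| * `|x| + `|y|))) => k.
  have -> : l (a *: x + y) - (a *: (l x : R^o) + l y) =
      (l (a *: x + y) - u k (a *: x + y)) - a * (l x - u k x) - (l y - u k y).
    by rewrite !dualE /GRing.scale /=; ring.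
  have h1 := lP (a *: x + y) k; have h2 := ler_wpM2l (normr_ge0 a) (lP x k).
  have h3 := lP y k.
  rewrite (le_trans (ler_normB _ _))// (le_trans (lerD (ler_normB _ _) h3))//.
  rewrite normrM (le_trans (lerD (lerD h1 h2) (lexx _)))// le_eqVlt.
  by apply/orP; left; apply/eqP; ring.
pose L : {linear V -> R^o} := HB.pack (l : V -> R^o)
  (GRing.isLinear.Build R V R^o *:%R _ llin).
have [x x1|f fE] := @dual_of_linear _ _ L (`|u 0%N| + 2 * c).
  have := lP x 0%N; rewrite expr0 divr1 ler_norml => /andP[+ _].
  have := dual_norm_apply_ge (u 0%N) x; rewrite /=.
  have := ler_wpM2l (normr_ge0 (u 0%N)) x1.
  have := ler_wpM2l c0 x1; lra.
exists f => k; apply: dual_norm_le => x x1.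
rewrite dual_addl dual_oppl fE (le_trans (lP _ _))//.
by rewrite ler_wpM2r ?invr_ge0 ?exprn_ge0// ler_piMr// mulr_ge0.
Qed.

End geometric.

(** The hypothesis says that [(x, xs)] is monotonically related to all of [T], so adding it keeps
    [T] monotone; maximality does the rest. *)
Lemma maximal_monotone_fitzpatrick (R : realType) (X : normedModType R)
    (T : set (X * dual X)) x xs : maximal_monotone_op (@duality R X) T ->
  fitzpatrick_le T (to_bidual x) xs (xs x) -> T (x, xs).
Proof.
move=> [Tmono Tmx] xT.
have pos y ys : T (y, ys) -> 0 <= (xs - ys) (x - y).
  by move=> /xT; rewrite !dualE; lra.
rewrite -(Tmx (T `|` [set (x, xs)])); [by right| |by move=> p Tp; left].
move=> [y ys] [z zs] [Ty|[-> ->]] [Tz|[-> ->]]; rewrite /duality.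
- exact: (Tmono _ _ Ty Tz).
- by have := pos _ _ Ty; rewrite !dualE; lra.
- by have := pos _ _ Tz; rewrite !dualE; lra.
- by suff : 0 <= (xs - xs) (x - x) by []; rewrite !dualE; lra.
Qed.

Section brondsted_rockafellar.
Context (R : realType) (X : completeNormedModType R) (T : set (X * dual X)).
Hypothesis Tmax : maximal_monotone_op (@duality R X) T.
Hypothesis TNI : negative_infimum T.

(** The gap drops from [eps] to an arbitrary [eta]. The distance is controlled by (NI) at the
    midpoint of the old and new points, which bounds [r] from below by [- eps] plus half of
    [ws w]. *)
Lemma fitzpatrick_le_refine x0 xs0 eps eta : 0 < eta ->
  fitzpatrick_le T (to_bidual x0) xs0 (xs0 x0 + eps) ->
  exists x xs, fitzpatrick_le T (to_bidual x) xs (xs x + eta) /\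
    `|x - x0| ^+ 2 + `|xs - xs0| ^+ 2 <= 4 * (eps + eta).
Proof.
move=> eta0 h0.
have [w [ws [r [hw rlt]]]] := fitzpatrick_le_approx Tmax.1 TNI x0 xs0 eta0.
have ww := dual_norm_apply_ge ws w; have sq := sqr_ge0 (`|w| - `|ws|).
exists (x0 + w), (xs0 + ws); split.
  by apply: fitzpatrick_le_trans hw; rewrite !dualE; nra.
rewrite addrAC subrr add0r addrAC subrr add0r.
have h : 0 <= (2^-1 : R) <= 1 by lra.
have := TNI (fitzpatrick_le_convex h h0 hw).
rewrite !dualE; nra.
Qed.

(** The refinement is iterated with gaps [d k ^+ 2]. Steps of length at most [3 * d k] sum up to
    [6 * delta], and the limit has gap zero, so it lies in [T] by maximality. *)
Lemma brondsted_rockafellar x0 xs0 delta : 0 < delta ->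
  fitzpatrick_le T (to_bidual x0) xs0 (xs0 x0 + delta ^+ 2) ->
  exists y ys, [/\ T (y, ys), `|y - x0| <= 6 * delta &
    `|ys - xs0| <= 6 * delta].
Proof.
move=> delta0 h0; pose d k := delta / 2 ^+ k.
have d0 k : 0 < d k by rewrite divr_gt0// exprn_gt0.
have dS k : d k.+1 = d k / 2 by rewrite /d exprS invfM mulrCA mulrC.
pose P k (p : X * dual X) :=
  fitzpatrick_le T (to_bidual p.1) p.2 (p.2 p.1 + d k ^+ 2).
(* The existential stands before the implication so that [choice] applies to all pairs; [0] is a
   dummy value for those violating [P]. *)
have step k p : exists q : X * dual X, P k p ->
    [/\ P k.+1 q, `|q.1 - p.1| <= 3 * d k & `|q.2 - p.2| <= 3 * d k].
  have [Pp|nPp] := pselect (P k p); last by exists 0.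
  have dd0 : 0 < d k.+1 ^+ 2 by rewrite exprn_gt0.
  have [x [xs [hx xle]]] := fitzpatrick_le_refine dd0 Pp.
  (* The refinement gives [4 * (d k ^+ 2 + d k ^+ 2 / 4) = 5 * d k ^+ 2], rounded up to
     [(3 * d k) ^+ 2]. *)
  exists (x, xs) => _; rewrite dS in xle; have dk := d0 k.
  have n1 := sqr_ge0 `|x - p.1|; have n2 := sqr_ge0 `|xs - p.2|.
  split=> //=; rewrite -ler_sqr ?nnegrE// ?mulr_ge0 ?ltW//; nra.
have [f fP] := choice (fun kp => step kp.1 kp.2).
pose u := fix u k := if k is k'.+1 then f (k', u k') else (x0, xs0).
have uP k : P k (u k).
  elim: k => [|k IH]; first by rewrite /P /d expr0 divr1.
  by have [] := fP (k, u k) IH.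
have [k|x xP] := @geometric_cvg _ _ (fun k => (u k).1) (3 * delta).
  by have [_ + _] := fP (k, u k) (uP k); rewrite mulrA.
have [k|xs xsP] := @geometric_cvg_dual _ _ (fun k => (u k).2) (3 * delta).
  by have [_ _] := fP (k, u k) (uP k); rewrite mulrA.
exists x, xs; split.
- apply: (maximal_monotone_fitzpatrick Tmax) => y ys Ty; rewrite -subr_le0.
  pose c := 2 * (3 * delta).
  (* The inequality [P k] at [(y, ys)] differs from the desired one by four pairings with [x - v] or
     [xs - vs] and by the gap, all of order [2 ^- k]. *)
  apply: (@le0_geometric _ _
    (c * (`|y| + `|ys| + (`|x| + c) + `|xs|) + delta ^+ 2)) => k.
  set v := (u k).1; set vs := (u k).2.
  have h1 : `|x - v| <= c / 2 ^+ k := xP k.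
  have h2 : `|xs - vs| <= c / 2 ^+ k := xsP k.
  have k1 : (2 ^+ k)^-1 <= 1 :> R.
    by rewrite invf_le1 ?exprn_gt0// exprn_ege1// ler1n.
  have c0 : 0 <= c by rewrite !mulr_ge0// ltW.
  have i0 : 0 <= (2 ^+ k)^-1 :> R by rewrite invr_ge0 exprn_ge0.
  have vb : `|v| <= `|x| + c.
    have := ler_distD x v 0; rewrite !subr0 distrC.
    have := ler_wpM2l c0 k1; lra.
  have := uP k _ _ Ty; rewrite -/v -/vs to_bidualE => hu.
  have b1 : (xs - vs) y <= c / 2 ^+ k * `|y|.
    rewrite (le_trans (ler_norm _))// (le_trans (dual_norm_apply _ _))//.
    by rewrite ler_wpM2r.
  have b2 : ys (x - v) <= c / 2 ^+ k * `|ys|.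
    rewrite (le_trans (ler_norm _))// (le_trans (dual_norm_apply _ _))//.
    by rewrite mulrC ler_wpM2r.
  have b3 : - (c / 2 ^+ k * (`|x| + c)) <= (xs - vs) v.
    rewrite (le_trans _ (dual_norm_apply_ge _ _))// lerN2 ler_pM//.
  have b4 : - (c / 2 ^+ k * `|xs|) <= xs (x - v).
    rewrite (le_trans _ (dual_norm_apply_ge _ _))// lerN2 mulrC ler_wpM2r//.
  have b5 : d k ^+ 2 <= delta ^+ 2 / 2 ^+ k.
    rewrite /d exprMn ler_wpM2l ?sqr_ge0// expr2 ler_piMr//.
  move: b1 b2 b3 b4 hu; rewrite !dualE mulrDl; nra.
- by have := xP 0%N; rewrite expr0 divr1 mulrA; congr (_ <= _ * _); ring.
- by have := xsP 0%N; rewrite expr0 divr1 mulrA; congr (_ <= _ * _); ring.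
Qed.

End brondsted_rockafellar.

(** * Approximation of the Gossez closure *)

Section dual_sum.
Context (R : realType) (V : normedModType R).

Lemma dual_suml n (F : 'I_n -> dual V) x :
  (\sum_(i < n) F i) x = \sum_(i < n) F i x :> R.
Proof. by elim/big_rec2: _ => // i y f _ <-. Qed.

Lemma dual_sumr n (f : dual V) (F : 'I_n -> V) :
  f (\sum_(i < n) F i) = \sum_(i < n) f (F i) :> R.
Proof. exact: linear_sum. Qed.

End dual_sum.

Section gossez_approximation.
Context (R : realType) (X : normedModType R) (T : set (X * dual X)).
Hypothesis Tmono : monotone_op (@duality R X) T.
Hypothesis TNI : negative_infimum T.
Variables (xss : dual (dual X)) (xs : dual X).
Hypothesis zT : fitzpatrick_le T xss xs (xss xs).

(* The Fitzpatrick function dominates the duality product and meets it at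
   [(xss, xs)], so by convexity it lies above the tangent there. *)
Lemma fitzpatrick_tangent a h k : 0 < k ->
  ~ fitzpatrick_le T a h (a xs + xss h - xss xs - k).
Proof.
move=> k0 ah; pose D : R := a h - a xs - xss h + xss xs.
have DE : D = a h - a xs - xss h + xss xs by [].
have kD : 0 < k + `|D| by rewrite ltr_wpDr.
(* Along the segment, (NI) reads [t ^+ 2 * D + t * k <= 0]; this [t] is small enough that
   [t * D + k > 0]. *)
pose t := k / (k + `|D|).
have tE : t * k + t * `|D| = k by rewrite -mulrDr divfK// gt_eqF.
have t0 : 0 < t by rewrite divr_gt0.
have t01 : 0 <= t <= 1.
  by rewrite ltW//= ler_pdivrMr// mul1r lerDl.
have := TNI (fitzpatrick_le_convex t01 ah zT); rewrite !dualE.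
clearbody D t.
have tD : - (t * `|D|) <= t * D.
  rewrite -mulrN ler_wpM2l ?(ltW t0)//.
  by have := ler_norm (- D); rewrite normrN; lra.
have tk : 0 < t * k by rewrite mulr_gt0.
have : 0 < t * (t * D + k) by rewrite mulr_gt0//; lra.
rewrite DE; nra.
Qed.

(** A Goldstine-type statement by penalization. Were the infimum at least [c], Fenchel duality would
    give a point [(a, h)] of X^** x X^* where [phi] lies below the tangent by [k]. The defects of
    the [f i] are carried by an auxiliary row vector, which makes the penalty a convex function of
    independent variables. *)
Lemma fitzpatrick_bidual_approx n (f : 'I_n -> dual X) (k A : R) :
  0 < k -> 0 <= A ->
  exists y ys r, fitzpatrick_le T (to_bidual y) ys r /\
    r + (k * `|y| ^+ 2 + A * `|ys - xs| ^+ 2 +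
      A * \sum_(i < n) `|f i y - xss (f i)|) < xss xs + k * (`|xss| ^+ 2 + 1).
Proof.
move=> k0 A0; set c := xss xs + _; apply: contrapT => nex.
pose N (p : (X * dual X) * 'rV[R]_n) : R := k * `|p.1.1| ^+ 2 +
  A * `|p.1.2| ^+ 2 + A * \sum_(i < n) `|p.2 0 i|.
have Nconv : convex_real N.
  apply: convex_realD; first apply: convex_realD; apply: convex_realZ => //.
  - exact: ltW.
  - apply: (convex_real_linear (k := fun x => `|x| ^+ 2)
      (L := fun p : (X * dual X) * 'rV[R]_n => p.1.1)) => //.
    exact: convex_real_sqnorm.
  - apply: (convex_real_linear (k := fun x => `|x| ^+ 2)
      (L := fun p : (X * dual X) * 'rV[R]_n => p.1.2)) => //.
    exact: convex_real_sqnorm.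
  - apply: convex_real_sum => i.
    apply: (convex_real_linear (k := fun x : R^o => `|x|)
      (L := fun p : (X * dual X) * 'rV[R]_n => p.2 0 i : R^o)).
      by move=> a p q; rewrite /= !mxE.
    exact: convex_real_norm.
pose w y := \row_(i < n) (f i y - xss (f i)).
pose G := [set p : ((X * dual X) * 'rV[R]_n) * R |
  fitzpatrick_le T (to_bidual p.1.1.1) (xs + p.1.1.2) p.2 /\
  p.1.2 = w p.1.1.1].
have GE y v u r : G (((y, v), u), r) =
  (fitzpatrick_le T (to_bidual y) (xs + v) r /\ u = w y) by [].
have Gconv : convex_epi G.
  have Gc y v u (y' : X) (v' : dual X) u' r r' t : 0 <= t <= 1 ->
      G (((y, v), u), r) -> G (((y', v'), u'), r') ->
      G (((t *: y + (1 - t) *: y', t *: v + (1 - t) *: v'),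
        t *: u + (1 - t) *: u'), t * r + (1 - t) * r').
    move=> t01; rewrite !GE => -[h ->] [h' ->]; split.
      have := fitzpatrick_le_convex t01 h h'.
      by rewrite to_bidual_addr !to_bidual_scaler convex_comb_shift.
    by apply/rowP => i; rewrite !mxE !dualE; ring.
  by move=> [[y v] u] r [[y' v'] u'] r' t; exact: Gc.
have GT y ys : T (y, ys) -> G (((y, ys - xs), w y), ys y).
  move=> Ty; rewrite GE; split=> //.
  by rewrite [_ + (_ - _)]addrC subrK; exact: fitzpatrick_le_graph.
have [[y0 ys0] T0] := negative_infimum_nonempty TNI.
have [|[[y v] u] r|g gP] := @fenchel_duality _ _ N G c Nconv Gconv.
- by eexists; exact: (GT _ _ T0).
- rewrite GE => -[h ->]; rewrite leNgt; apply/negP => lt; apply: nex.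
  exists y, (xs + v), r; split=> //.
  have -> : xs + v - xs = v by rewrite addrAC subrr add0r.
  move: lt; rewrite /N /=; congr (_ + (_ + _ * _) < _).
  by apply: eq_bigr => i _; rewrite mxE.
have [g12 [g3 gE]] := linear_pairE g.
have [g1 [g2 g12E]] := linear_pairE g12.
pose K := ys0 y0 + k + A - c - g ((y0, ys0 - xs), w y0).
have gb p : N p <= k + A -> - K <= g p.
  by move=> Np; have := gP _ _ p (GT _ _ T0); rewrite /K; lra.
have sum0 : \sum_(i < n) `|(0 : 'rV[R]_n) 0 i| = 0.
  by rewrite big1// => i _; rewrite mxE normr0.
have sq1 (V : normedModType R) (v : V) : `|v| <= 1 -> `|v| ^+ 2 <= 1.
  by move=> v1; rewrite expr_le1.
have [x x1|b bE] := @dual_of_linear _ _ g1 K.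
  have := gb ((x, 0), 0); rewrite gE g12E !linear0 !addr0; apply.
  rewrite /N /= normr0 sum0 expr0n mulr0 !addr0.
  by have := ler_wpM2l (ltW k0) (sq1 _ _ x1); lra.
have [x x1|a aE] := @dual_of_linear _ _ g2 K.
  have := gb ((0, x), 0); rewrite gE g12E !linear0 !addr0 add0r; apply.
  rewrite /N /= normr0 sum0 expr0n !mulr0 add0r addr0.
  by have := ler_wpM2l A0 (sq1 _ _ x1); lra.
(* A functional on rows is a combination of coordinates; composed with [w], it only shifts the dual
   point from [b] to [b + f0]. *)
pose lam i : R := g3 (delta_mx 0 i).
pose f0 := \sum_(i < n) lam i *: f i.
have g3w y : g3 (w y) = f0 y - xss f0 :> R.
  rewrite [w y]row_sum_delta linear_sum /f0 dual_suml dual_sumr -sumrB.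
  apply: eq_bigr => i _; rewrite !dualE linearZ /w mxE.
  by transitivity ((f i y - xss (f i)) * lam i); last by rewrite mulrC mulrBr.
pose h := b + f0.
apply: (@fitzpatrick_tangent a h k k0) => y ys Ty.
pose F := h y + a ys - ys y - a xs - xss f0 + c.
have /sqnorm_conjugate-/(_ k0) bF : forall u, F <= k * `|u| ^+ 2 + b u.
  move=> u; have := gP _ _ ((u, 0), 0) (GT _ _ Ty).
  rewrite !gE !g12E !linear0 g3w -!bE -!aE /N /= normr0 sum0 expr0n.
  by rewrite /F /h !dualE !mulr0 !addr0; lra.
(* Completing the square in the norm of [b] costs [k] times the squared norm of [xss], which [c]
   provides; the remaining [k] in [c] contradicts the tangent bound. *)
have xb := dual_norm_apply_ge xss b; have sq := sqr_ge0 (`|b| - 2 * k * `|xss|).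
have : F + `|xss| * `|b| - k * `|xss| ^+ 2 <= 0.
  have k4 : 0 < 4 * k by rewrite mulr_gt0.
  by rewrite -(pmulr_rle0 _ k4); nra.
rewrite /F /h /c !dualE; lra.
Qed.

End gossez_approximation.

Lemma net_tails_filter (I : Type) (le : I -> I -> Prop) : directed le ->
  ProperFilter (net_tails le).
Proof.
move=> [[i0] le_refl le_trans le_dir]; apply: filter_from_proper.
  apply: filter_from_filter; first by exists i0.
  move=> i j _ _; have [k [ik jk]] := le_dir i j; exists k => // m km.
  by split; [exact: le_trans km|exact: le_trans km].
by move=> i _; exists i; exact: le_refl.
Qed.

(** * From approximate points to bounded nets in the graph *)

Section gossez_approximation_graph.
Context (R : realType).

Lemma fitzpatrick_bidual_seq (X : normedModType R) (T : set (X * dual X))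
    (xss : dual (dual X)) (xs : dual X) (l : seq (dual X)) (tau : R) :
  monotone_op (@duality R X) T -> negative_infimum T ->
  fitzpatrick_le T xss xs (xss xs) -> 0 < tau ->
  exists y ys, [/\ fitzpatrick_le T (to_bidual y) ys (ys y + tau),
    `|y| ^+ 2 <= 2 * (`|xss| ^+ 2 + 1), `|ys - xs| <= tau &
    forall f, f \in l -> `|f y - xss f| <= tau].
Proof.
move=> Tmono TNI zT tau0; pose L : R := `|xss| ^+ 2 + 1.
have L1 : 1 <= L by rewrite lerDr sqr_ge0.
(* At the end the gap [r - ys y] is at most [k * L + S + d * m], hence at most [4 * L ^+ 2 * k]. *)
pose k := Num.min 1 (tau / (4 * L ^+ 2)).
have L2 : 0 < 4 * L ^+ 2 by rewrite mulr_gt0// exprn_gt0//; lra.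
have k0 : 0 < k by rewrite lt_min ltr01 divr_gt0.
have k1 : k <= 1 by rewrite ge_min lexx.
have ktau : 4 * L ^+ 2 * k <= tau.
  by rewrite mulrC -ler_pdivlMr// ge_min lexx orbT.
have kL0 : 0 < k * L by rewrite mulr_gt0//; lra.
have kLtau : 4 * (k * L) <= tau.
  have : 0 <= 4 * (k * L) * (L - 1) by rewrite !mulr_ge0 ?(ltW kL0)//; lra.
  lra.
pose i := k^-1; have ki : k * i = 1 by rewrite divff// gt_eqF.
have i0 : 0 < i by rewrite invr_gt0.
(* The term [1] absorbs the error [S] on [xs y], [i / 2] absorbs the [d ^+ 2] part of [d * m], and
   the last [i = k^-1] leaves [d ^+ 2] and [S] of order [k ^+ 2]. *)
pose A := 1 + i / 2 + i.
have A0 : 0 <= A by rewrite /A; lra.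
(* Testing [xs] as well keeps [xs y] close to [xss xs], which is needed to bound [ys y] from
   below. *)
pose s := xs :: l.
have [y [ys [r [yr hr]]]] := fitzpatrick_bidual_approx Tmono TNI zT
  (tnth (in_tuple s)) k0 A0.
have sP f : f \in s -> `|f y - xss f| <=
    \sum_(j < size s) `|tnth (in_tuple s) j y - xss (tnth (in_tuple s) j)|.
  move=> /(@tnthP _ _ (in_tuple s)) [j ->].
  by rewrite (bigD1 j)//= lerDl sumr_ge0.
move: hr sP; set S := \sum_(_ < _) _; rewrite -/L => hr sP.
have S0 : 0 <= S by rewrite sumr_ge0.
have xsP : xs y - xss xs >= - S.
  have /sP : xs \in s by rewrite inE eqxx.
  by rewrite ler_norml => /andP[].
have yrge : ys y <= r := TNI _ _ _ yr.
set m := `|y| in hr *; set d := `|ys - xs| in hr *.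
have m0 : 0 <= m by exact: normr_ge0.
have d0 : 0 <= d by exact: normr_ge0.
have ysge : xs y - d * m <= ys y.
  by have := dual_norm_apply_ge (ys - xs) y; rewrite !dualE -/m -/d; lra.
have dm : 2 * (d * m) <= k * m ^+ 2 + i * d ^+ 2.
  have : 0 <= i * (d - k * m) ^+ 2 by rewrite mulr_ge0 ?sqr_ge0// ltW.
  have -> : i * (d - k * m) ^+ 2 =
    i * d ^+ 2 - 2 * (k * i) * (d * m) + (k * i) * k * m ^+ 2 by ring.
  by rewrite ki; lra.
have hA : k * m ^+ 2 / 2 + (1 + i) * d ^+ 2 + (i / 2 + i) * S < k * L.
  by move: hr; rewrite /A; lra.
have d20 : 0 <= d ^+ 2 by exact: sqr_ge0.
have m20 : 0 <= k * m ^+ 2 by rewrite mulr_ge0 ?sqr_ge0// ltW.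
have iS0 : 0 <= i * S by rewrite mulr_ge0// ltW.
have id0 : 0 <= i * d ^+ 2 by rewrite mulr_ge0// ltW.
have m2 : m ^+ 2 <= 2 * L.
  by rewrite -(ler_pM2l k0); lra.
have ik (x : R) : i * x <= k * L -> x <= k * (k * L).
  move=> ix; have := ler_wpM2l (ltW k0) ix.
  by rewrite [k * (i * x)]mulrA ki mul1r.
have kkL : k * (k * L) <= k * L by rewrite ler_piMl// ltW.
have SkL : S <= k * L by rewrite (le_trans _ kkL)// ik//; lra.
have d2 : d ^+ 2 <= k * (k * L) by apply: ik; lra.
have dkL : d <= k * L.
  rewrite -ler_sqr ?nnegrE ?(ltW kL0)// (le_trans d2)//.
  have -> : (k * L) ^+ 2 = k * (k * L) * L by ring.
  by rewrite ler_peMr// mulr_ge0 ?(ltW k0) ?(ltW kL0).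
have mL : m <= 2 * L.
  rewrite -ler_sqr ?nnegrE//; last lra.
  rewrite (le_trans m2)//; nra.
have dmL : d * m <= 2 * L ^+ 2 * k.
  rewrite (le_trans (ler_pM d0 m0 dkL mL))// le_eqVlt.
  by apply/orP; left; apply/eqP; ring.
have LkL : k * L <= L ^+ 2 * k.
  have : 0 <= k * L * (L - 1) by rewrite mulr_ge0 ?(ltW kL0)//; lra.
  lra.
have Ad : 0 <= A * d ^+ 2 by rewrite mulr_ge0.
have AS : 0 <= A * S by rewrite mulr_ge0.
exists y, ys; split=> //.
- apply: fitzpatrick_le_trans yr; lra.
- by rewrite (le_trans dkL)//; lra.
- by move=> f fl; rewrite (le_trans (sP f _)) ?inE ?fl ?orbT//; lra.
Qed.

Context (X : completeNormedModType R) (T : set (X * dual X)).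
Hypothesis Tmax : maximal_monotone_op (@duality R X) T.
Hypothesis TNI : negative_infimum T.

Lemma graph_bidual_seq (xss : dual (dual X)) (xs : dual X)
    (l : seq (dual X)) (tau : R) :
  fitzpatrick_le T xss xs (xss xs) -> 0 < tau <= 1 ->
  exists p : X * dual X, [/\ T p, `|p.1| <= 2 * (`|xss| ^+ 2 + 1) + 1,
    `|p.2 - xs| <= tau & forall f, f \in l -> `|f p.1 - xss f| <= tau].
Proof.
move=> zT /andP[tau0 tau1].
pose S := \sum_(f <- l) `|f|; have S0 : 0 <= S by exact: sumr_ge0.
(* Moving by [rho] in X changes each [f] in [l] by at most [rho * S <= tau / 2]; the other half of
   [tau] is left for [sig]. *)
pose rho := tau / (2 * (1 + S)).
have S2 : 0 < 2 * (1 + S) by lra.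
have rho0 : 0 < rho by rewrite divr_gt0.
have rhoS : 2 * rho * S + 2 * rho = tau by rewrite /rho; field; lra.
have rhoS0 : 0 <= rho * S by rewrite mulr_ge0// ltW.
pose delta := rho / 6; have delta0 : 0 < delta by rewrite divr_gt0.
have delta6 : 6 * delta = rho by rewrite /delta; field.
pose sig := Num.min (delta ^+ 2) (tau / 2).
have sig0 : 0 < sig by rewrite lt_min exprn_gt0//= divr_gt0.
have sig1 : sig <= delta ^+ 2 by rewrite ge_min lexx.
have sig2 : sig <= tau / 2 by rewrite ge_min lexx orbT.
have [y [ys [yT yb yxs yl]]] := fitzpatrick_bidual_seq l Tmax.1 TNI zT sig0.
have [|z [zs [Tz zy zys]]] := brondsted_rockafellar Tmax TNI delta0
  (x0 := y) (xs0 := ys).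
  by apply: fitzpatrick_le_trans yT; lra.
rewrite delta6 in zy zys; exists (z, zs); split=> //=.
- have := ler_distD y z 0; rewrite !subr0.
  have : `|y| <= 2 * (`|xss| ^+ 2 + 1).
    rewrite -ler_sqr ?nnegrE// ?(le_trans yb)//.
    by have := sqr_ge0 `|xss|; nra.
  have := sqr_ge0 `|xss|; lra.
- by have := ler_distD ys zs xs; lra.
- move=> f fl; have := ler_distD (f y) (f z) (xss f).
  have := yl f fl; have : `|f z - f y| <= rho * S.
    have -> : f z - f y = f (z - y) by rewrite !dualE.
    rewrite (le_trans (dual_norm_apply _ _))// mulrC ler_pM//.
    by rewrite /S (big_rem f fl)/= lerDl sumr_ge0.
  lra.
Qed.

(** The net is indexed by a finite list of functionals, ordered by inclusion, and a precision. The
    norm bound of [graph_bidual_seq] does not depend on either, so the net is bounded. *)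
Lemma negative_infimum_type_D : gossez_type_D T.
Proof.
move=> xss xs zg.
have zT : fitzpatrick_le T xss xs (xss xs).
  move=> y ys /zg; rewrite /biduality.
  suff -> : (xss, xs).1 = xss by rewrite !dualE; lra.
  by [].
have tau n : 0 < (n.+1%:R^-1 : R) <= 1.
  by rewrite invr_gt0 ltr0n /= invf_le1 ?ltr0n// ler1n.
have [z zP] := choice (fun i : seq (dual X) * nat =>
  graph_bidual_seq i.1 zT (tau i.2)).
pose le (i j : seq (dual X) * nat) := {subset i.1 <= j.1} /\ (i.2 <= j.2)%N.
have dir : directed le.
  split.
  - by constructor; exact: ([::], 0%N).
  - by move=> i; split.
  - move=> i j k [ij1 ij2] [jk1 jk2]; split; last exact: leq_trans jk2.
    by move=> f /ij1/jk1.
  - move=> i j; exists (i.1 ++ j.1, maxn i.2 j.2).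
    by split; split=> /=; rewrite ?leq_maxl ?leq_maxr// => f fi;
      rewrite mem_cat fi ?orbT.
exists _, le, z; split=> //.
- by move=> i; have [] := zP i.
- exists (2 * (`|xss| ^+ 2 + 1) + 1 + (1 + `|xs|)); split; first exact: num_real.
  move=> M ltM _ [i _ <-] /=; rewrite (le_trans _ (ltW ltM))//.
  have [_ z1 z2 _] := zP i; have /andP[_ /(le_trans z2) {}z2] := tau i.2.
  have := sqr_ge0 `|xss|; have := normr_ge0 xs.
  have := ler_distD xs (z i).2 0; rewrite !subr0.
  by rewrite prod_normE ge_max => *; apply/andP; split; lra.
have FF := net_tails_filter dir.
have tauP (e : R) : 0 < e -> exists n, forall m, (n <= m)%N -> m.+1%:R^-1 < e.
  move=> e0; exists (Num.truncn e^-1) => m nm.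
  rewrite invf_plt ?posrE ?ltr0n//.
  by rewrite (lt_le_trans (truncnS_gt _))// ler_nat ltnS.
have c1 : (to_bidual (z i).1 : weak_star (dual X)) @[i --> net_tails le] -->
    (xss : weak_star (dual X)).
  apply/weak_star_cvgP => f; apply/cvgrPdist_lt => e /tauP[n nP].
  exists ([:: f], n) => // j [/= fj nj]; rewrite distrC.
  have [_ _ _ /(_ f)] := zP j; rewrite fj ?inE ?eqxx// => /(_ isT)/le_lt_trans.
  by apply; exact: nP.
have c2 : (z i).2 @[i --> net_tails le] --> xs.
  apply/cvgrPdist_lt => e /tauP[n nP]; exists ([::], n) => // j [/= _ nj].
  rewrite distrC; have [_ _ + _] := zP j; move=> /le_lt_trans; apply; exact: nP.
exact: cvg_pair c1 c2.
Qed.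

End gossez_approximation_graph.

(** * Uniqueness of the extension *)

(** Zorn's lemma is applied to the sets whose union with [T] is monotone, so that the empty chain is
    no exception. *)
Lemma monotone_op_extend (R : realType) (U W : zmodType) (pair : U -> W -> R)
    (T : set (U * W)) : monotone_op pair T ->
  exists S, maximal_monotone_op pair S /\ T `<=` S.
Proof.
move=> Tmono.
have [F FP Ftot|A [PA Amax]] :=
    @Zorn_bigcup _ (fun A => monotone_op pair (T `|` A)).
  move=> p q [Tp|[B FB Bp]] [Tq|[C FC Cq]].
  - exact: Tmono.
  - by apply: (FP _ FC); [left|right].
  - by apply: (FP _ FB); [right|left].
  - have [BC|CB] := Ftot _ _ FB FC.
      by apply: (FP _ FC); right => //; exact: BC.
    by apply: (FP _ FB); right => //; exact: CB.
exists (T `|` A); split; last by left.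
split=> // S Smono TAS; apply/seteqP; split=> //.
apply: contrapT => nST; apply: (Amax S); last first.
  by move=> p q [Tp|Sp] [Tq|Sq]; apply: Smono => //; apply: TAS; left.
split; first by move=> p Ap; apply: TAS; right.
by move=> SA; apply: nST => p /SA; right.
Qed.

Section uniqueness.
Context (R : realType) (X : normedModType R) (T : set (X * dual X)).
Hypothesis Tmax : maximal_monotone_op (@duality R X) T.

Definition closure_monotone := monotone_op (@biduality R X) (gossez_closure T).

Lemma gossez_closure_fitzpatrick xss xs :
  gossez_closure T (xss, xs) <-> fitzpatrick_le T xss xs (xss xs).
Proof.
split=> zT y ys Ty.
  have : 0 <= (xss - to_bidual y) (xs - ys) := zT _ _ Ty.
  by rewrite !dualE; lra.
suff : 0 <= (xss - to_bidual y) (xs - ys) by [].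
by have := zT _ _ Ty; rewrite !dualE; lra.
Qed.

Lemma graph_gossez_closure x xs : T (x, xs) -> gossez_closure T (to_bidual x, xs).
Proof.
move=> Tx; apply/gossez_closure_fitzpatrick.
exact: fitzpatrick_le_graph Tmax.1 Tx.
Qed.

(** Every monotone extension lies in the closure, by monotonicity against [T]. If the closure is
    itself monotone, it is therefore the only maximal one. *)
Lemma closure_monotone_unique : closure_monotone ->
  exists! S, maximal_monotone_extension T S.
Proof.
move=> cm; have ext S : monotone_op (@biduality R X) S ->
    (forall x xs, T (x, xs) -> S (to_bidual x, xs)) -> S `<=` gossez_closure T.
  by move=> Smono TS p Sp y ys Ty; exact: (Smono _ _ Sp (TS _ _ Ty)).
exists (gossez_closure T); split.
  split; last exact: graph_gossez_closure.
  split=> // S Smono cS; apply/seteqP; split=> //; apply: ext => // x xs Tx.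
  exact/cS/graph_gossez_closure.
move=> S [[Smono Smax] TS]; apply: Smax => //; exact: ext.
Qed.

(** Any [z] in the closure can be added to [T] and the result extended to a maximal operator, which
    must be [S]; hence [S] contains the closure. *)
Lemma unique_closure_monotone :
  (exists! S, maximal_monotone_extension T S) -> closure_monotone.
Proof.
move=> [S [[[Smono Smax] TS] Suniq]].
suff cS : gossez_closure T `<=` S by move=> p q /cS Sp /cS; exact: Smono.
move=> z zT.
pose S0 := [set p | p = z \/
  exists y ys, T (y, ys) /\ p = (to_bidual y, ys)].
have [|S' [S'max S0S']] := @monotone_op_extend _ _ _ (@biduality R X) S0.
  move=> p q [->|[y [ys [Ty ->]]]] [->|[w [ws [Tw ->]]]].
  - suff : 0 <= (z.1 - z.1) (z.2 - z.2) by [].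
    by rewrite !dualE; lra.
  - exact: zT.
  - suff : 0 <= (to_bidual y - z.1) (ys - z.2) by [].
    have : 0 <= (z.1 - to_bidual y) (z.2 - ys) := zT _ _ Ty.
    by rewrite !dualE; lra.
  - suff : 0 <= (to_bidual y - to_bidual w) (ys - ws) by [].
    have : 0 <= (ys - ws) (y - w) := Tmax.1 _ _ Ty Tw.
    by rewrite !dualE; lra.
rewrite (Suniq S'); first by apply: S0S'; left.
by split=> // x xs Tx; apply: S0S'; right; exists x, xs.
Qed.

(** Maximality lets segments in [T] be prolonged to rays, then to lines; a nonempty set containing
    its lines is affine. *)
Lemma maximal_monotone_convex_affine :
  (forall p q t, 0 <= t <= 1 -> T p -> T q -> T (p + t *: (q - p))) ->
  affine_subspace T.
Proof.
move=> Tconv; have Tmono := Tmax.1.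
have ray p q t : 0 <= t -> T p -> T q -> T (p + t *: (q - p)).
  move=> t0 Tp Tq; have [t1|t1] := leP t 1.
    by apply: Tconv => //; rewrite t0.
  rewrite [p + _]surjective_pairing.
  apply: (maximal_monotone_fitzpatrick Tmax) => y ys Ty.
  have tp : 0 < t by lra.
  (* The homothety of center [p] and ratio [t] sends this point of the segment to [(y, ys)] and [q]
     to the point under test. Monotonicity against [q], multiplied by [t ^+ 2], is the required
     inequality. *)
  have : T (p + t^-1 *: ((y, ys) - p)).
    by apply: Tconv => //; rewrite invr_ge0 t0 invf_le1// ltW.
  move=> /(Tmono _ _ Tq).
  have tV (V : lmodType R) (a b c : V) :
      t *: (b - (a + t^-1 *: (c - a))) = a + t *: (b - a) - c.
    rewrite opprD addrA scalerBr scalerA divff ?gt_eqF// scale1r opprB.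
    by rewrite addrCA addrA.
  pose u := q.1 - (p.1 + t^-1 *: (y - p.1)).
  pose us := q.2 - (p.2 + t^-1 *: (ys - p.2)).
  move=> qs; have : 0 <= us u := qs.
  move=> /(mulr_ge0 (sqr_ge0 t)).
  have -> : t ^+ 2 * us u = (t *: us) (t *: u) by rewrite !dualE; ring.
  rewrite /us /u !tV; set x := p.1 + t *: _; set xs := p.2 + t *: _.
  suff : 0 <= (xs - ys) (x - y) -> xs y + ys x - ys y <= xs x by [].
  by rewrite !dualE; lra.
have line p q t : T p -> T q -> T (p + t *: (q - p)).
  move=> Tp Tq; have [t0|t0] := leP 0 t; first exact: ray.
  have -> : p + t *: (q - p) = q + (1 - t) *: (p - q).
    by rewrite scalerBl scale1r addrA [q + (p - q)]addrC subrK -scalerN opprB.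
  by apply: ray => //; lra.
have [p0 Tp0] : T !=set0.
  apply: contrapT => T0; apply: (T0); exists (0, 0).
  apply: (maximal_monotone_fitzpatrick Tmax) => y ys Ty.
  by exfalso; apply: T0; exists (y, ys).
exists p0, (fun v => `[< T (p0 + v) >]); split.
  split; first by apply/asboolP; rewrite addr0.
  move=> a u v /asboolP Tu /asboolP Tv; apply/asboolP.
  (* Relative to [p0], [a *: u + v] is the midpoint of [(2 * a) *: u] and [2 *: v]. *)
  have := line _ _ (2 * a) Tp0 Tu; have := line _ _ 2 Tp0 Tv.
  have E w : p0 + w - p0 = w by rewrite addrAC subrr add0r.
  rewrite !E => T2v T2u; have := line _ _ 2^-1 T2u T2v.
  suff -> : p0 + (2 * a) *: u + 2^-1 *: (p0 + 2 *: v - (p0 + (2 * a) *: u)) =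
    p0 + (a *: u + v) by [].
  rewrite opprD addrACA subrr add0r scalerBr !scalerA mulrA mulVf// mul1r.
  rewrite scale1r -addrA [v - _]addrC; congr (_ + _); rewrite addrA -scalerBl.
  by congr (_ *: _ + _); ring.
apply/seteqP; split=> [p Tp|_ [v /asboolP Tv <-]//].
by exists (p - p0); [apply/asboolP|]; rewrite addrC subrK.
Qed.

End uniqueness.

(** * Class (NI) from a monotone closure, and a monotone closure from type (D) *)

Section type_D.
Context (R : realType) (X : normedModType R) (T : set (X * dual X)).

Lemma closure_monotone_negative_infimum :
  maximal_monotone_op (@duality R X) T -> ~ affine_subspace T ->
  closure_monotone T -> negative_infimum T.
Proof.
move=> Tmax Tnaff cm xss0 xs0 r0 z0T; rewrite leNgt; apply/negP => r0lt.
apply: Tnaff; pose zt a h t : dual (dual X) * dual X :=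
  (t *: a + (1 - t) *: xss0, t *: h + (1 - t) *: xs0).
have near0 a h r : fitzpatrick_le T a h r -> exists t0, [/\ 0 < t0, t0 <= 1 &
    forall t, 0 < t <= t0 -> gossez_closure T (zt a h t)].
  (* Along the segment, the duality product minus the interpolated bound on [phi] is
     [d + t * b + t ^+ 2 * c], positive at [t = 0]. *)
  move=> ahT; pose d := xss0 xs0 - r0; have d0 : 0 < d by rewrite subr_gt0.
  pose b := a xs0 + xss0 h - 2 * xss0 xs0 + r0 - r.
  pose c := a h - a xs0 - xss0 h + xss0 xs0.
  have bc : 0 < 1 + `|b| + `|c|.
    by have := normr_ge0 b; have := normr_ge0 c; lra.
  exists (Num.min 1 (d / (1 + `|b| + `|c|))); split.
  - by rewrite lt_min ltr01 divr_gt0.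
  - by rewrite ge_min lexx.
  move=> t; rewrite le_min ler_pdivlMr// => /and3P[t0 t1 td].
  apply/gossez_closure_fitzpatrick.
  have t01 : 0 <= t <= 1 by rewrite ltW.
  apply: fitzpatrick_le_trans (fitzpatrick_le_convex t01 ahT z0T).
  have tb : - (t * `|b|) <= t * b.
    rewrite -mulrN ler_wpM2l ?(ltW t0)//.
    by have := ler_norm (- b); rewrite normrN; lra.
  have tc : - (t * `|c|) <= t ^+ 2 * c.
    apply: (@le_trans _ _ (t * - `|c|)); first by rewrite mulrN.
    rewrite expr2 -mulrA ler_wpM2l ?(ltW t0)//.
    have := ler_norm (- c); rewrite normrN => cN.
    have : t * `|c| <= `|c| by rewrite ler_piMl.
    have : - (t * `|c|) <= t * c.
      by rewrite -mulrN ler_wpM2l ?(ltW t0)//; lra.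
    lra.
  have : 0 <= d + t * b + t ^+ 2 * c by lra.
  by rewrite /d /b /c !dualE; lra.
have dom_mono a h r a' h' r' : fitzpatrick_le T a h r ->
    fitzpatrick_le T a' h' r' -> 0 <= (a - a') (h - h').
  move=> /near0[t [t0 t1 tP]] /near0[t' [t'0 t'1 t'P]].
  (* At a common parameter [s], the points of the two segments differ by [s] times the difference of
     their endpoints. *)
  pose s := Num.min t t'; have s0 : 0 < s by rewrite lt_min t0.
  have st : 0 < s <= t by rewrite s0 ge_min lexx.
  have st' : 0 < s <= t' by rewrite s0 ge_min lexx orbT.
  have : 0 <= (s *: a + (1 - s) *: xss0 - (s *: a' + (1 - s) *: xss0))
      (s *: h + (1 - s) *: xs0 - (s *: h' + (1 - s) *: xs0)) :=
    cm _ _ (tP _ st) (t'P _ st').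
  have addrBK (V : zmodType) (x y z : V) : x + z - (y + z) = x - y.
    by rewrite opprD addrACA subrr addr0.
  rewrite !addrBK -!scalerBr dual_scalel dual_scaler mulrA.
  by rewrite pmulr_rge0// mulr_gt0.
have dom_closure a h r : fitzpatrick_le T a h r -> gossez_closure T (a, h).
  move=> ahT y ys Ty.
  exact: dom_mono ahT (fitzpatrick_le_graph Tmax.1 Ty).
(* The domain of [phi] is convex and lies in the closure, whose points coming from X x X^* belong to
   [T] by maximality; so [T] is convex. *)
apply: maximal_monotone_convex_affine => // -[x xs] [y ys] t t01 Tx Ty.
have -> : (x, xs) + t *: ((y, ys) - (x, xs)) =
    (t *: y + (1 - t) *: x, t *: ys + (1 - t) *: xs).
  have E (V : lmodType R) (u v : V) : u + t *: (v - u) = t *: v + (1 - t) *: u.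
    by rewrite scalerBr scalerBl scale1r addrCA.
  by rewrite -!E.
apply: (maximal_monotone_fitzpatrick Tmax).
apply/gossez_closure_fitzpatrick; rewrite to_bidual_addr !to_bidual_scaler.
apply: dom_closure; apply: fitzpatrick_le_convex => //;
  exact: fitzpatrick_le_graph Tmax.1 _.
Qed.

(** Only one of the two points is approximated by a net in [T]; the other is monotonically related
    to each member of it. Boundedness of the net allows passing to the limit in the pairing of its
    two components. *)
Lemma type_D_closure_monotone : gossez_type_D T -> closure_monotone T.
Proof.
move=> TD; suff cm (pss qss : dual (dual X)) (ps qs : dual X) :
    gossez_closure T (pss, ps) -> gossez_closure T (qss, qs) ->
    0 <= (pss - qss) (ps - qs).
  by move=> [pss ps] [qss qs]; exact: cm.
move=> pT qT; have [I [le [z [dir zT zb zcvg]]]] := TD _ _ pT.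
have FF := net_tails_filter dir.
have /weak_star_cvgP z1 : (to_bidual (z i).1 : weak_star (dual X))
    @[i --> net_tails le] --> (pss : weak_star (dual X)).
  exact: (cvg_comp _ _ zcvg cvg_fst).
have /cvgrPdist_lt z2 : (z i).2 @[i --> net_tails le] --> ps.
  exact: (cvg_comp _ _ zcvg cvg_snd).
have [M [_ zM]] := zb; pose B := `|M| + 1.
have zB i : `|(z i).1| <= B.
  have /zM/(_ (z i)) : M < B by rewrite /B; have := ler_norm M; lra.
  move=> /(_ (ex_intro2 _ _ i Logic.I erefl)) /=.
  by rewrite prod_normE ge_max => /andP[].
have B0 : 0 <= B by rewrite addr_ge0.
apply/ler_addgt0Pr => e e0.
have D0 : 0 < 2 + B + `|qss| by have := normr_ge0 qss; lra.
(* The error has four parts: [d] for each of the weak-star tests at [ps] and [qs], and [d] times [B]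
   and the norm of [qss] for the strong convergence. *)
pose d := e / (2 + B + `|qss|); have d0 : 0 < d by rewrite divr_gt0.
have dE : 2 * d + d * B + d * `|qss| = e by rewrite /d; field; rewrite gt_eqF.
have /cvgrPdist_lt/(_ _ d0) np := z1 ps.
have /cvgrPdist_lt/(_ _ d0) nq := z1 qs.
have [i [[ip iq] i2]] := filter_ex (filterI (filterI np nq) (z2 _ d0)).
have : 0 <= (qss - to_bidual (z i).1) (qs - (z i).2).
  by apply: qT; rewrite -surjective_pairing.
have : pss ps - ps (z i).1 >= - d by rewrite lerNnormlW// ltW.
have : pss qs - qs (z i).1 <= d by rewrite (le_trans (ler_norm _))// ltW.
have : - (d * B) <= (ps - (z i).2) (z i).1.
  rewrite (le_trans _ (dual_norm_apply_ge _ _))// lerN2 ler_pM//; exact: ltW.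
have : qss (ps - (z i).2) <= d * `|qss|.
  rewrite (le_trans (ler_norm _))// (le_trans (dual_norm_apply _ _))// mulrC.
  by rewrite ler_wpM2r// ltW.
rewrite !dualE; lra.
Qed.

End type_D.

Theorem corollary4p6 (R : realType) (X : completeNormedModType R)
    (T : set (X * dual X)) :
  maximal_monotone_op (@duality R X) T ->
  ~ affine_subspace T ->
  (exists! S : set (dual (dual X) * dual X), maximal_monotone_extension T S)
  <-> gossez_type_D T.
Proof.
move=> Tmax Tnaff; split.
  move=> /(unique_closure_monotone Tmax) cm.
  exact: negative_infimum_type_D (closure_monotone_negative_infimum _ _ cm).
by move=> /type_D_closure_monotone; exact: closure_monotone_unique.
Qed.
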